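(* Let $\mathcal H^2$ be a two-dimensional complex Hilbert space with orthonormal basis $h_{01},h_{02}$, let $\lambda_0\in\mathbb C$ with $\operatorname{Im}\lambda_0>0$, let $T_a$ be the linear operator in $\mathcal H^2$ with matrix $\begin{pmatrix}\bar\lambda_0&0\\0&-\lambda_0\end{pmatrix}$ in this basis, let $K:\mathbb C^2\to\mathcal H^2$ be given by $K(c_1,c_2)^T=\sqrt{\operatorname{Im}\lambda_0}\,(c_1h_{01}+c_2h_{02})$, let $J_a=-I$ on $\mathbb C^2$, and let $$\Theta_a=\begin{pmatrix}T_a&K&J_a\\ \mathcal H^2&&\mathbb C^2\end{pmatrix}$$ be the canonical L-system with main operator $T_a$, channel operator $K$ and directing operator $J_a$. Then the accumulation coefficient $\mathcal A_a$ of $\Theta_a$ is $$\mathcal A_a=\frac{8\operatorname{Im}\lambda_0\,(|\lambda_0|^2+1)}{(|\lambda_0|^2+2\operatorname{Im}\lambda_0+1)^2}.$$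
   Context: $\operatorname{Im}T=\frac1{2i}(T-T^* )$. A canonical L-system is an array $\Theta=\begin{pmatrix}T&K&J\\ \mathcal H&&E\end{pmatrix}$, where $\mathcal H,E$ are Hilbert spaces with $\dim E<\infty$, $T$ is a bounded operator in $\mathcal H$ (main operator), $K:E\to\mathcal H$ is bounded (channel operator), $J$ is a bounded self-adjoint unitary operator in $E$ (directing operator), and $\operatorname{Im}T=KJK^*$. Its transfer function is $W_\Theta(z)=I-2iK^*(T-zI)^{-1}KJ$, $z\in\rho(T)$. The c-Entropy of $\Theta$ is $\mathcal S=-\operatorname{tr}\ln(|W_\Theta(-i)|)$, where $|W|=(W^*W)^{1/2}$. Convention: if $-i\notin\rho(T)$ (here exactly when $\lambda_0=i$), $\mathcal S$ is understood as the limit in $[-\infty,+\infty]$ of $-\operatorname{tr}\ln(|W_\Theta(z)|)$ as $z\to -i$, $z\neq -i$. If $\mathcal S<0$, the coefficient of accumulation of $\Theta$ is $\mathcal A=1-e^{2\mathcal S}$, with $e^{-\infty}=0$. *)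

(* Defs.v *)
From HB Require Import structures.
From mathcomp Require Import all_boot all_order all_algebra.
From mathcomp Require Import sesquilinear.
From mathcomp Require Export complex.
From mathcomp Require Import zify.
From mathcomp Require Import all_classical all_reals all_analysis.

Set Implicit Arguments.
Unset Strict Implicit.
Unset Printing Implicit Defensive.

Import Order.TTheory GRing.Theory Num.Theory.
Import numFieldNormedType.Exports.

Local Open Scope classical_set_scope.
Local Open Scope ring_scope.

Definition dot_norm (R : realType) (U : lmodType R[i])
    (dot : {dot U for Num.conj}) (x : U) : R :=
  Num.sqrt (complex.Re (dot x x)).

Definition dot_complete (R : realType) (U : lmodType R[i])
    (dot : {dot U for Num.conj}) : Prop :=
  forall u : nat -> U,
    (forall eps : R, 0 < eps -> exists N : nat, forall m n : nat,
       (N <= m)%N -> (N <= n)%N -> dot_norm dot (u m - u n) < eps) ->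
    exists l : U, forall eps : R, 0 < eps -> exists N : nat, forall n : nat,
       (N <= n)%N -> dot_norm dot (u n - l) < eps.

(* The inner product is linear in its first argument and conjugate-linear in
   its second one. *)
Record hilbertSpace (R : realType) := HilbertSpace {
  hcarrier :> lmodType R[i];
  hdot : {dot hcarrier for Num.conj};
  hdotP : dot_complete hdot }.

Section Cn.
Variables (R : realType) (n : nat).
Local Notation C := R[i].

Definition cdot (u v : 'cV[C]_n) : C := \sum_i u i 0 * Num.conj (v i 0).

Fact cdot_linearl v : linear_for *%R (cdot^~ v).
Proof.
move=> a u w; rewrite /cdot mulr_sumr -big_split; apply: eq_bigr => i _ /=.
by rewrite !mxE mulrDl mulrA.
Qed.

Fact cdot_linearr u : linear_for (Num.conj \; *%R) (cdot u).
Proof.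
move=> a v w; rewrite /cdot /= mulr_sumr -big_split; apply: eq_bigr => i _ /=.
by rewrite !mxE rmorphD rmorphM mulrDr mulrCA.
Qed.

HB.instance Definition _ :=
  bilinear_isBilinear.Build C _ _ C *%R (Num.conj \; *%R) cdot
    (cdot_linearl, cdot_linearr).

Fact cdot_herm : forall u v, cdot u v = (-1) ^+ false * Num.conj (cdot v u).
Proof.
move=> u v; rewrite expr0 mul1r /cdot rmorph_sum; apply: eq_bigr => i _ /=.
by rewrite rmorphM /= conjCK mulrC.
Qed.

HB.instance Definition _ := isHermitianSesquilinear.Build C 'cV[C]_n false
  Num.conj cdot cdot_herm.

Fact cdot_gt0 : forall u, u != 0 -> 0 < cdot u u.
Proof.
move=> u u0; rewrite lt_def; apply/andP; split; last first.
  by apply: sumr_ge0 => i _; apply: mul_conjC_ge0.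
apply: contra u0 => /eqP; rewrite /cdot => /psumr_eq0P h.
apply/eqP/colP => i; rewrite mxE; apply/eqP; rewrite -mul_conjC_eq0; apply/eqP.
by apply: h => // j _; apply: mul_conjC_ge0.
Qed.

HB.instance Definition _ := isDotProduct.Build C 'cV[C]_n cdot cdot_gt0.

Fact dot_normE (u : 'cV[C]_n) : dot_norm cdot u =
  Num.sqrt (\sum_i (complex.Re (u i 0) ^+ 2 + complex.Im (u i 0) ^+ 2)).
Proof.
rewrite /dot_norm /cdot; congr Num.sqrt.
rewrite (raddf_sum (@complex.Re R)); apply: eq_bigr => i _.
by case: (u i 0) => a b /=; rewrite mulrN opprK -!expr2.
Qed.

Fact cdot_complete : dot_complete cdot.
Proof.
move=> u Hu.
have key (f : C -> R) : (forall x y, f (x - y) = f x - f y) ->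
    (forall x : C, f x ^+ 2 <= complex.Re x ^+ 2 + complex.Im x ^+ 2) ->
    forall i, exists l : R, forall eps : R, 0 < eps -> exists N : nat,
      forall k, (N <= k)%N -> `|f (u k i 0) - l| < eps.
  move=> fB fle i.
  have cv : cvgn (fun k => f (u k i 0)).
    apply: cauchy_cvg; apply/cauchy_exP => e e0.
    have [N HN] := Hu e e0; exists (f (u N i 0)).
    exists N => // k /= Nk; rewrite -ball_normE /=.
    apply: le_lt_trans (HN N k (leqnn N) Nk).
    rewrite -fB -sqrtr_sqr dot_normE ler_wsqrtr // (le_trans (fle _)) //.
    rewrite (bigD1 i) //= !mxE lerDl.
    by apply: sumr_ge0 => j _; rewrite addr_ge0 ?sqr_ge0.
  exists (limn (fun k => f (u k i 0))) => e e0.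
  move/cvgrPdist_lt : cv => /(_ e e0) [N _ HN]; exists N => k Nk.
  by rewrite distrC; exact: HN.
have /choice[a Ha] : forall i, exists l : R, forall eps : R, 0 < eps ->
    exists N : nat, forall k, (N <= k)%N ->
      `|complex.Re (u k i 0) - l| < eps.
  by apply: key => [[? ?] [? ?]|x] //; rewrite lerDl sqr_ge0.
have /choice[b Hb] : forall i, exists l : R, forall eps : R, 0 < eps ->
    exists N : nat, forall k, (N <= k)%N ->
      `|complex.Im (u k i 0) - l| < eps.
  by apply: key => [[? ?] [? ?]|x] //; rewrite lerDr sqr_ge0.
exists (\col_i (a i +i* b i)%C) => eps eps0.
pose d := eps / (2 * n.+1%:R).
have d0 : 0 < d by rewrite divr_gt0 // mulr_gt0 // ltr0n.
have /choice[Na HNa] i := Ha i d d0.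
have /choice[Nb HNb] i := Hb i d d0.
exists (\max_i maxn (Na i) (Nb i))%N => k Nk.
rewrite dot_normE -[ltRHS](gtr0_norm eps0) -sqrtr_sqr ltr_sqrt ?exprn_gt0 //.
apply: (@le_lt_trans _ _ (\sum_(i < n) (d ^+ 2 + d ^+ 2))).
  apply: ler_sum => i _; rewrite !mxE.
  have ki : (maxn (Na i) (Nb i) <= k)%N by apply: leq_trans Nk; apply: leq_bigmax.
  move: ki; rewrite geq_max => /andP[/HNa ka /HNb kb].
  move: ka kb; case: (u k i 0) => x y /= ka kb.
  by apply: lerD; rewrite -real_normK ?num_real // lerXn2r ?nnegrE // ltW.
have epsE : eps = d * (2 * n.+1%:R).
  by rewrite /d divfK // mulf_neq0 ?pnatr_eq0.
rewrite sumr_const card_ord epsE -mulr2n -mulrnA -[ltLHS]mulr_natr [ltRHS]exprMn.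
rewrite ltr_pM2l ?exprn_gt0 // -natrM -natrX ltr_nat expnMn.
by rewrite expnS expn1; nia.
Qed.

Definition Cn : hilbertSpace R := HilbertSpace cdot_complete.

End Cn.

Section Operators.
Variable R : realType.
Local Notation C := R[i].
Implicit Types H E : hilbertSpace R.

Definition bounded_op H E (f : H -> E) : Prop :=
  exists M : R, forall x : H,
    dot_norm (hdot E) (f x) <= M * dot_norm (hdot H) x.

(* For bounded linear f, the vector w exists by the Riesz representation
   theorem and is unique. *)
Definition adjoint H E (f : H -> E) : E -> H := fun y =>
  xget 0 [set w : H | forall x : H, hdot E (f x) y = hdot H x w].

Definition im_op H (T : H -> H) : H -> H := fun x =>
  (2 * 'i%C)^-1 *: (T x - adjoint T x).

Definition self_adjoint H (f : H -> H) : Prop := adjoint f =1 f.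

Definition unitary_op H (f : H -> H) : Prop :=
  cancel f (adjoint f) /\ cancel (adjoint f) f.

Definition resolvent_set H (T : H -> H) : set C :=
  [set z | exists S : H -> H, [/\ bounded_op S,
     cancel (fun x => T x - z *: x) S & cancel S (fun x => T x - z *: x)]].

Definition resolvent H (T : H -> H) (z : C) : H -> H := fun y =>
  xget 0 [set x : H | T x - z *: x = y].

Definition finite_dim E : Prop :=
  exists (n : nat) (e : 'I_n -> E),
    forall x : E, exists c : 'I_n -> C, x = \sum_i c i *: e i.

Definition orthonormal_basis E (n : nat) (e : 'I_n -> E) : Prop :=
  (forall i j, hdot E (e i) (e j) = (i == j)%:R) /\
  (forall x : E, exists c : 'I_n -> C, x = \sum_i c i *: e i).

(* The function f of a self-adjoint operator A on a finite-dimensional space,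
   by spectral decomposition: if e is an orthonormal basis with
   A (e i) = d i *: e i, then f(A) maps e i to f (d i) *: e i. *)
Definition fun_calc E (f : R -> R) (A : E -> E) : E -> E := fun x =>
  xget 0 [set y : E | exists (n : nat) (e : 'I_n -> E) (d : 'I_n -> R),
    [/\ orthonormal_basis e,
        forall i, A (e i) = (d i)%:C%C *: e i
      & y = \sum_i (hdot E x (e i) * (f (d i))%:C%C) *: e i]].

Definition abs_op E (W : E -> E) : E -> E :=
  fun_calc Num.sqrt (adjoint W \o W).

(* The value does not depend on the orthonormal basis; it is 0 when E has no
   finite one. *)
Definition trace_op E (A : E -> E) : C :=
  xget 0 [set t : C | exists (n : nat) (e : 'I_n -> E), orthonormal_basis e /\
    t = \tr (\matrix_(i, j) hdot E (A (e j)) (e i))].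

(* - tr ln |W|; the trace is that of a self-adjoint operator, hence real.
   For singular W, ln |W| has the eigenvalue ln 0 = -oo, so the value is +oo
   (the library's ln is 0 at 0). *)
Definition neg_tr_ln_abs E (W : E -> E) : \bar R :=
  if `[< bijective W >]
  then (- complex.Re (trace_op (fun_calc (@ln R) (abs_op W))))%:E
  else +oo%E.

Section LSystem.
Variables (H E : hilbertSpace R).
Variables (T : {linear H -> H}) (K : {linear E -> H}) (J : {linear E -> E}).

Record canonical_L_system : Prop := CanonicalLSystem {
  lsys_finite_dim : finite_dim E;
  lsys_main_bounded : bounded_op T;
  lsys_channel_bounded : bounded_op K;
  lsys_directing_bounded : bounded_op J;
  lsys_directing_self_adjoint : self_adjoint J;
  lsys_directing_unitary : unitary_op J;
  lsys_im : im_op T =1 K \o J \o adjoint K }.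

Definition transfer_fun (z : C) : E -> E := fun e =>
  e - (2 * 'i%C) *: adjoint K (resolvent T z (K (J e))).

(* When -i is not in the resolvent set of T, the entropy is the limit at -i
   over the domain of the transfer function. *)
Definition c_entropy : \bar R :=
  if `[< resolvent_set T (- 'i%C) >]
  then neg_tr_ln_abs (transfer_fun (- 'i%C))
  else lim (neg_tr_ln_abs (transfer_fun z) @[z -->
         within (resolvent_set T) ((- 'i%C : C^o)^')]).

(* Meaningful when c_entropy < 0; expeR -oo = 0. *)
Definition accumulation_coef : R :=
  1 - fine (expeR (2%:E * c_entropy)).

End LSystem.
End Operators.

(* Main.v *)
Require Import Defs.
From mathcomp Require Import all_boot all_order all_algebra.
From mathcomp Require Import complex sesquilinear.
From mathcomp Require Import all_classical all_reals all_analysis.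
From mathcomp Require Import ring lra.

(** Every operator in sight is diagonal with respect to the basis [h] of the
    state space and the standard basis of the channel space: [T] has the
    coefficients [t k], with [t 0] the conjugate of [lambda0] and [t 1] equal to
    [- lambda0], both of imaginary part [- b] for [b] the imaginary part of
    [lambda0], while [K] is [sqrt b] and [J] is [- 1]. Adjoints, products and
    resolvents of such operators are computed coefficient by coefficient, so
    the transfer function is diagonal (lemma [diagonal_transfer_fun]), with
    coefficients the quotients of [(t k)^* - z] by [t k - z].

    The functional calculus and the trace are independent of the orthonormal
    eigenbasis chosen to compute them ([fun_calc_diag_op], [trace_diag_op]), so
    the entropy is the sum over [k] of [ln |t k + i| - ln |(t k)^* + i|]
    ([diagonal_c_entropy]). The two eigenvalues of [T] are mirror images in the
    imaginary axis, hence equidistant from [- i], and so are their conjugates: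
    with [D = |lambda0|^2 - 2 b + 1] and [N = |lambda0|^2 + 2 b + 1] these
    squared distances are [D] and [N], whence [exp (2 S) = (D / N)^2] and
    [1 - (D / N)^2 = (N - D) (N + D) / N^2] is the asserted value.

    When [lambda0 = i], both eigenvalues of [T] sit at [- i] and [D = 0]. There
    the entropy is a limit, equal to [-oo] ([diagonal_entropy_pole]), which
    agrees with [exp (2 S) = (D / N)^2 = 0]. *)

Set Implicit Arguments.
Unset Strict Implicit.
Unset Printing Implicit Defensive.

Import Order.TTheory GRing.Theory Num.Theory.
Import numFieldNormedType.Exports.

Local Open Scope classical_set_scope.
Local Open Scope ring_scope.

(** * Orthonormal bases *)

Lemma normE_normc (R : realType) (x : R[i]) : `|x| = (Normc.normc x)%:C%C.
Proof. by []. Qed.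

Lemma normc_gt0 (R : realType) (x : R[i]) :
  (0 < Normc.normc x) = (x != 0).
Proof. by rewrite -normr_gt0 normE_normc ltcR. Qed.

Lemma normc_ge0 (R : realType) (x : R[i]) : 0 <= Normc.normc x.
Proof. by case: x => *; exact: sqrtr_ge0. Qed.

Section OrthonormalBases.
Variable R : realType.
Local Notation C := R[i].
Implicit Types H E G : hilbertSpace R.

Lemma hdotC E (x y : E) : hdot E x y = Num.conj (hdot E y x).
Proof. by rewrite (hermC (hdot E)) expr0 mul1r. Qed.

Lemma hdotZl E a (x y : E) : hdot E (a *: x) y = a * hdot E x y.
Proof. exact: (linearZl_LR (hdot E)). Qed.

Lemma hdotZr E a (x y : E) : hdot E x (a *: y) = Num.conj a * hdot E x y.
Proof. by rewrite hdotC hdotZl rmorphM /= -hdotC. Qed.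

Lemma hdot_suml E n (F : 'I_n -> E) (y : E) :
  hdot E (\sum_i F i) y = \sum_i hdot E (F i) y.
Proof. exact: (linear_sumlz (hdot E)). Qed.

Lemma hdot_sumr E n (x : E) (F : 'I_n -> E) :
  hdot E x (\sum_i F i) = \sum_i hdot E x (F i).
Proof. exact: (linear_sumr (hdot E)). Qed.

Lemma hdot_inj E (w w' : E) :
  (forall x, hdot E x w = hdot E x w') -> w = w'.
Proof.
move=> ww'; apply/eqP; rewrite -subr_eq0; apply/negPn/negP => n0.
have : 0 < hdot E (w - w') (w - w') by rewrite dnorm_gt0.
have -> : hdot E (w - w') (w - w') = hdot E (w - w') w - hdot E (w - w') w'.
  exact: (linearBr (hdot E)).
by rewrite ww' subrr ltxx.
Qed.

Section Basis.
Variables (E : hilbertSpace R) (n : nat) (e : 'I_n -> E).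
Hypothesis he : orthonormal_basis e.

Lemma hdot_coord (c : 'I_n -> C) j : hdot E (\sum_i c i *: e i) (e j) = c j.
Proof.
rewrite hdot_suml (bigD1 j) //= hdotZl (he.1 j j) eqxx mulr1 big1 ?addr0 //.
by move=> i ij; rewrite hdotZl (he.1 i j) (negbTE ij) mulr0.
Qed.

Lemma basis_expansion x : x = \sum_i hdot E x (e i) *: e i.
Proof.
have [c ->] := he.2 x.
by apply: eq_bigr => i _; rewrite hdot_coord.
Qed.

Lemma parseval x y :
  hdot E x y = \sum_i hdot E x (e i) * Num.conj (hdot E y (e i)).
Proof.
rewrite {1}(basis_expansion x) hdot_suml; apply: eq_bigr => i _.
by rewrite hdotZl (hdotC (e i) y).
Qed.

End Basis.

(** * Operators that are diagonal in a pair of orthonormal bases *)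

(** The two bases are independent of each other so that the main operator, the
    channel operator, the directing operator and all their adjoints and
    products are of this one form. *)
Definition diag_op H E n (e : 'I_n -> H) (f : 'I_n -> E) (d : 'I_n -> C) :
  H -> E := fun x => \sum_i (d i * hdot H x (e i)) *: f i.

Lemma diag_op_id E n (e : 'I_n -> E) : orthonormal_basis e ->
  diag_op e e (fun=> 1) = id.
Proof.
move=> he; apply/funext => x; rewrite /diag_op [RHS](basis_expansion he).
by apply: eq_bigr => i _; rewrite mul1r.
Qed.

Lemma diag_opZ H E n (e : 'I_n -> H) (f : 'I_n -> E) d a x :
  a *: diag_op e f d x = diag_op e f (fun i => a * d i) x.
Proof.
by rewrite /diag_op scaler_sumr; apply: eq_bigr => i _; rewrite scalerA mulrA.
Qed.

Lemma diag_opB H E n (e : 'I_n -> H) (f : 'I_n -> E) d d' x :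
  diag_op e f d x - diag_op e f d' x = diag_op e f (fun i => d i - d' i) x.
Proof.
rewrite /diag_op -sumrB; apply: eq_bigr => i _.
by rewrite -scalerBl mulrBl.
Qed.

Lemma diag_op_comp H E G n (e : 'I_n -> H) (f : 'I_n -> E) (g : 'I_n -> G)
    d d' x : orthonormal_basis f ->
  diag_op f g d' (diag_op e f d x) = diag_op e g (fun i => d' i * d i) x.
Proof.
move=> hf; rewrite {1}/diag_op; apply: eq_bigr => i _.
by rewrite /diag_op hdot_coord // mulrA.
Qed.

Lemma diag_op_basis H E n (e : 'I_n -> H) (f : 'I_n -> E) d i :
  orthonormal_basis e -> diag_op e f d (e i) = d i *: f i.
Proof.
move=> he; rewrite /diag_op (bigD1 i) //= (he.1 i i) eqxx mulr1 big1 ?addr0 //.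
by move=> j ji; rewrite (he.1 i j) eq_sym (negbTE ji) mulr0 scale0r.
Qed.

Lemma linear_diag_op H E n (e : 'I_n -> H) (f : 'I_n -> E) d
    (A : {linear H -> E}) : orthonormal_basis e ->
  (forall i, A (e i) = d i *: f i) -> (A : H -> E) = diag_op e f d.
Proof.
move=> he Ae; apply/funext => x; rewrite {1}(basis_expansion he x) linear_sum.
by apply: eq_bigr => i _; rewrite linearZ Ae /= scalerA mulrC.
Qed.

(** The adjoint is chosen among the vectors with the adjunction property, and
    nondegeneracy of the inner product leaves only one candidate. *)
Lemma adjointE H E (f : H -> E) (g : E -> H) :
  (forall x y, hdot E (f x) y = hdot H x (g y)) -> adjoint f = g.
Proof.
move=> fg; apply/funext => y; rewrite /adjoint.
case: xgetP => [w _ /= wP|/(_ (g y)) /=].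
  by apply: hdot_inj => x; rewrite -wP fg.
by case=> x; rewrite fg.
Qed.

Lemma adjoint_diag_op H E n (e : 'I_n -> H) (f : 'I_n -> E) d :
  adjoint (diag_op e f d) = diag_op f e (fun i => Num.conj (d i)).
Proof.
apply: adjointE => x y; rewrite /diag_op hdot_suml hdot_sumr.
apply: eq_bigr => i _; rewrite hdotZl hdotZr rmorphM /= conjCK (hdotC (f i)).
by rewrite mulrAC.
Qed.

(** By Parseval the norm of the image is computed coordinatewise, so any upper
    bound of the moduli of the coefficients will do; their sum is one. *)
Lemma bounded_diag_op H E n (e : 'I_n -> H) (f : 'I_n -> E) d :
  orthonormal_basis e -> orthonormal_basis f -> bounded_op (diag_op e f d).
Proof.
move=> he hf; exists (\sum_i Normc.normc (d i)) => x.
set M := \sum_i _.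
have M0 : 0 <= M by apply: sumr_ge0 => i _; exact: normc_ge0.
rewrite /dot_norm -{1}(ger0_norm M0) -sqrtr_sqr -sqrtrM ?sqr_ge0 //.
apply: ler_wsqrtr; rewrite (parseval hf) (parseval he x x).
rewrite !(raddf_sum (@complex.Re R)) mulr_sumr; apply: ler_sum => i _.
rewrite /diag_op hdot_coord //.
have dM : Normc.normc (d i) <= M.
  by rewrite /M (bigD1 i) //= lerDl; apply: sumr_ge0 => j _; exact: normc_ge0.
have : Normc.normc (d i) ^+ 2 <= M ^+ 2.
  by rewrite lerXn2r // nnegrE normc_ge0.
case: (d i) => a b; case: (hdot H x (e i)) => u v /=.
rewrite sqr_sqrtr ?addr_ge0 ?sqr_ge0 // => abM.
have uv : 0 <= u ^+ 2 + v ^+ 2 by rewrite addr_ge0 ?sqr_ge0.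
move: (ler_wpM2r uv abM); rewrite !expr2; lra.
Qed.


Lemma diag_op_inv H n (e : 'I_n -> H) d : orthonormal_basis e ->
  (forall i, d i != 0) ->
  cancel (diag_op e e d) (diag_op e e (fun i => (d i)^-1)).
Proof.
move=> he d0 x; rewrite diag_op_comp //.
rewrite (_ : (fun i => _) = fun=> 1) ?diag_op_id //.
by apply/funext => i; rewrite mulVf.
Qed.

Lemma diag_op_invr H n (e : 'I_n -> H) d : orthonormal_basis e ->
  (forall i, d i != 0) ->
  cancel (diag_op e e (fun i => (d i)^-1)) (diag_op e e d).
Proof.
move=> he d0 x; rewrite diag_op_comp //.
rewrite (_ : (fun i => _) = fun=> 1) ?diag_op_id //.
by apply/funext => i; rewrite mulfV.
Qed.

Lemma diag_op_shift H n (e : 'I_n -> H) t z x : orthonormal_basis e ->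
  diag_op e e t x - z *: x = diag_op e e (fun i => t i - z) x.
Proof.
move=> he; rewrite -{2}[x](congr1 (@^~ x) (diag_op_id he)) diag_opZ diag_opB.
by congr (diag_op e e _ x); apply/funext => i; rewrite mulr1.
Qed.

(** If [z = t i], then [e i] and [0] have the same image under the shifted
    operator, which therefore has no left inverse. *)
Lemma resolvent_set_diag_op H n (e : 'I_n -> H) t z : orthonormal_basis e ->
  resolvent_set (diag_op e e t) z <-> forall i, t i != z.
Proof.
move=> he; split=> [[S [_ SK _]] i|tz].
  apply/negP => /eqP tz.
  have diag_e : diag_op e e t (e i) = z *: e i.
    by rewrite diag_op_basis // tz.
  have diag_0 : diag_op e e t 0 = 0.
    rewrite /diag_op big1 // => j _.
    by rewrite (linear0l (hdot H)) mulr0 scale0r.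
  have := SK (e i); rewrite diag_e subrr.
  have := SK 0; rewrite diag_0 scaler0 subrr => -> e0.
  have := he.1 i i; rewrite -e0 eqxx (linear0l (hdot H)) => /eqP.
  by rewrite eq_sym oner_eq0.
have tz0 i : t i - z != 0 by rewrite subr_eq0.
exists (diag_op e e (fun i => (t i - z)^-1)); split.
- exact: bounded_diag_op.
- by move=> x; rewrite diag_op_shift //; exact: diag_op_inv.
- by move=> x; rewrite diag_op_shift //; exact: diag_op_invr.
Qed.

Lemma resolvent_diag_op H n (e : 'I_n -> H) t z : orthonormal_basis e ->
  (forall i, t i != z) ->
  resolvent (diag_op e e t) z = diag_op e e (fun i => (t i - z)^-1).
Proof.
move=> he tz; apply/funext => y.
have tz0 i : t i - z != 0 by rewrite subr_eq0.
rewrite /resolvent; case: xgetP => [x _ /= <-|].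
  by rewrite diag_op_shift // diag_op_inv.
move/(_ (diag_op e e (fun i => (t i - z)^-1) y)) => /=.
by rewrite diag_op_shift // diag_op_invr.
Qed.

(** * Functional calculus, trace and entropy of a diagonal operator *)

(** The functional calculus may be computed in any eigenbasis [e']. Eigenvectors
    [e' i] and [e k] are orthogonal unless their eigenvalues agree, so replacing
    [f (d' i)] by [f (d k)] in the coordinate along [e k] changes nothing. *)
Lemma fun_calc_diag_op E n (e : 'I_n -> E) (f : R -> R) (d : 'I_n -> R) :
  orthonormal_basis e ->
  fun_calc f (diag_op e e (fun i => (d i)%:C%C)) =
  diag_op e e (fun i => (f (d i))%:C%C).
Proof.
move=> he; set A := diag_op e e _; apply/funext => x; rewrite /fun_calc.
case: xgetP => [y _ /= [m [e' [d' [he' Ae' ->]]]]|]; last first.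
  move=> /(_ (diag_op e e (fun i => (f (d i))%:C%C) x)) /=; case.
  exists n, e, d; split=> // [i|]; first exact: diag_op_basis.
  by apply: eq_bigr => i _; rewrite mulrC.
rewrite [LHS](basis_expansion he); apply: eq_bigr => k _; congr (_ *: _).
rewrite hdot_suml [in RHS](basis_expansion he' x) hdot_suml mulr_sumr.
apply: eq_bigr => i _; rewrite !hdotZl mulrAC -mulrA [RHS]mulrCA; congr (_ * _).
rewrite mulrC.
have : (d' i)%:C%C * hdot E (e' i) (e k) = (d k)%:C%C * hdot E (e' i) (e k).
  by rewrite -hdotZl -Ae' /A /diag_op hdot_coord.
move/eqP; rewrite -subr_eq0 -mulrBl mulf_eq0 => /orP[|/eqP->].
  by rewrite subr_eq0 => /eqP[->].
by rewrite !mulr0.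
Qed.

(** In another basis [e'] the trace is the double sum over [i] and [k] of
    [d k] times the squared modulus of the inner product of [e k] and [e' i];
    summed over [i] first, it collapses by Parseval to the sum of the [d k]. *)
Lemma trace_diag_op E n (e : 'I_n -> E) (d : 'I_n -> C) :
  orthonormal_basis e -> trace_op (diag_op e e d) = \sum_i d i.
Proof.
move=> he; rewrite /trace_op.
have key m (e' : 'I_m -> E) : orthonormal_basis e' ->
    \tr (\matrix_(i, j) hdot E (diag_op e e d (e' j)) (e' i)) = \sum_i d i.
  move=> he'; rewrite /mxtrace.
  under eq_bigr do rewrite mxE /diag_op hdot_suml.
  rewrite exchange_big; apply: eq_bigr => k _ /=.
  under eq_bigr do rewrite hdotZl -mulrA [_ * hdot E (e k) _]mulrC.
  rewrite -mulr_sumr.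
  under eq_bigr do rewrite (hdotC _ (e k)).
  by rewrite -parseval // (he.1 k k) eqxx mulr1.
case: xgetP => [t _ /= [m [e' [he' ->]]]|]; first exact: key.
move=> /(_ (\tr (\matrix_(i, j) hdot E (diag_op e e d (e j)) (e i)))) /=; case.
by exists n, e.
Qed.

Lemma abs_diag_op E n (e : 'I_n -> E) (w : 'I_n -> C) : orthonormal_basis e ->
  abs_op (diag_op e e w) = diag_op e e (fun i => (Normc.normc (w i))%:C%C).
Proof.
move=> he; rewrite /abs_op adjoint_diag_op.
rewrite (_ : _ \o _ = diag_op e e (fun i => (Normc.normc (w i) ^+ 2)%:C%C)).
  rewrite fun_calc_diag_op //; congr diag_op; apply/funext => i.
  by rewrite sqrtr_sqr ger0_norm // normc_ge0.
apply/funext => x /=; rewrite diag_op_comp //; congr (diag_op e e _ x).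
by apply/funext => i; rewrite mulrC -normCK rmorphXn.
Qed.

Lemma neg_tr_ln_abs_diag_op E n (e : 'I_n -> E) (w : 'I_n -> C) :
  orthonormal_basis e -> (forall i, w i != 0) ->
  neg_tr_ln_abs (diag_op e e w) = (- \sum_i ln (Normc.normc (w i)))%:E.
Proof.
move=> he w0; rewrite /neg_tr_ln_abs asboolT; last first.
  exists (diag_op e e (fun i => (w i)^-1)).
    exact: diag_op_inv.
  exact: diag_op_invr.
rewrite abs_diag_op // fun_calc_diag_op // trace_diag_op //.
by rewrite (raddf_sum (@complex.Re R)).
Qed.

Definition std_basis n : 'I_n -> Cn R n := fun i => (delta_mx i 0 : 'cV[C]_n).

Lemma std_basis_orthonormal n : orthonormal_basis (@std_basis n).
Proof.
split=> [i j|x].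
  rewrite /= /cdot (bigD1 j) //= big1 => [|k kj].
    by rewrite !mxE !eqxx andbT addr0 conjC1 mulr1 eq_sym.
  by rewrite !mxE (negbTE kj) conjC0 mulr0.
exists (fun i => (x : 'cV[C]_n) i 0).
rewrite {1}(matrix_sum_delta (x : 'cV[C]_n)); apply: eq_bigr => i _.
by rewrite big_ord1.
Qed.

End OrthonormalBases.

(** * Systems with a diagonal main operator *)

Section DiagonalSystem.
Variables (R : realType) (H : hilbertSpace R) (n : nat) (h : 'I_n -> H).
Hypothesis hh : orthonormal_basis h.
Variables (t : 'I_n -> R[i]) (b : R).
Hypothesis b_ge0 : 0 <= b.
Hypothesis Im_t : forall i, complex.Im (t i) = - b.
Variables (T : {linear H -> H}) (K : {linear Cn R n -> H})
  (J : {linear Cn R n -> Cn R n}).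
Local Notation delta := (@std_basis R n).
Hypothesis TE : (T : H -> H) = diag_op h h t.
Hypothesis KE : (K : Cn R n -> H) =
  diag_op delta h (fun=> (Num.sqrt b)%:C%C).
Hypothesis JE : (J : Cn R n -> Cn R n) =
  diag_op delta delta (fun=> -1).

Let hd : orthonormal_basis delta := std_basis_orthonormal R n.

Lemma adjoint_channel : adjoint K = diag_op h delta
  (fun=> (Num.sqrt b)%:C%C).
Proof.
rewrite KE adjoint_diag_op; congr diag_op; apply/funext => i.
exact: conjc_real.
Qed.

(** Both sides of [Im T = K J K^*] are [- b] times the identity, since every
    eigenvalue of [T] has imaginary part [- b]. *)
Lemma diagonal_canonical_L_system : canonical_L_system T K J.
Proof.
have JA : adjoint J = J.
  rewrite JE adjoint_diag_op; congr diag_op; apply/funext => i.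
  by rewrite rmorphN1.
have JJ : cancel J J.
  move=> x; rewrite JE diag_op_comp //.
  rewrite (_ : (fun i => _) = fun=> 1) ?diag_op_id //.
  by apply/funext => i; rewrite mulrNN mulr1.
split.
- by exists n, delta; exact: hd.2.
- by rewrite TE; exact: bounded_diag_op.
- by rewrite KE; exact: bounded_diag_op.
- by rewrite JE; exact: bounded_diag_op.
- by rewrite /self_adjoint JA.
- by split; rewrite JA.
- move=> x /=; rewrite adjoint_channel KE JE /im_op TE adjoint_diag_op.
  rewrite diag_opB diag_opZ !diag_op_comp //.
  congr (diag_op h h _ x); apply/funext => i.
  apply: (mulfI (_ : 2 * 'i%C != 0)).
    by rewrite mulf_neq0 ?pnatr_eq0 // complexiE neq0Ci.
  rewrite mulVKf; last by rewrite mulf_neq0 ?pnatr_eq0 // complexiE neq0Ci.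
  rewrite mulrN1 mulNr -rmorphM -expr2 sqr_sqrtr //.
  by rewrite (subcJ (t i) : _ - Num.conj _ = _) Im_t rmorphN mulrAC mulrN.
Qed.

(** The coefficient of index [k] is [1 + 2 i b / (t k - z)], and [2 i b] is the
    conjugate of [t k] minus [t k] itself. *)
Lemma diagonal_transfer_fun z : (forall i, t i != z) ->
  transfer_fun T K J z = diag_op delta delta
    (fun i => (Num.conj (t i) - z) / (t i - z)).
Proof.
move=> tz; apply/funext => x; rewrite /transfer_fun adjoint_channel KE JE TE.
rewrite resolvent_diag_op //.
rewrite !diag_op_comp // diag_opZ.
rewrite -{1}[x](congr1 (@^~ x) (diag_op_id hd)) diag_opB.
congr (diag_op delta delta _ x); apply/funext => i.
have tz0 : t i - z != 0 by rewrite subr_eq0.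
apply: (mulIf tz0); rewrite divfK //.
rewrite mulrN1 !mulrN opprK mulrDl mul1r.
set s := (Num.sqrt b)%:C%C; set r := _^-1.
have -> : 2 * 'i%C * (s * r * s) * (t i - z) = 2 * 'i%C * (s * s).
  by rewrite -mulrA (mulrAC s r) mulfVK.
rewrite -rmorphM -expr2 sqr_sqrtr // addrAC; congr (_ - z).
have := subcJ (t i); rewrite Im_t rmorphN mulrAC mulrN => tJ.
by apply/eqP; rewrite -subr_eq0 addrAC (tJ : t i - Num.conj (t i) = _) addNr.
Qed.

Lemma diagonal_neg_tr_ln_abs z :
  (forall i, t i != z) -> (forall i, Num.conj (t i) != z) ->
  neg_tr_ln_abs (transfer_fun T K J z) =
  (\sum_i (ln (Normc.normc (t i - z)) -
           ln (Normc.normc (Num.conj (t i) - z))))%:E.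
Proof.
move=> tz tz'; have tz0 i : t i - z != 0 by rewrite subr_eq0.
have tz0' i : Num.conj (t i) - z != 0 by rewrite subr_eq0.
rewrite diagonal_transfer_fun // neg_tr_ln_abs_diag_op //; last first.
  by move=> i; rewrite mulf_neq0 ?invr_eq0.
rewrite -sumrN; congr EFin; apply: eq_bigr => i _.
rewrite Normc.normcM Normc.normcV lnM ?posrE ?invr_gt0 ?normc_gt0 //.
by rewrite lnV ?posrE ?normc_gt0 // opprD opprK addrC.
Qed.

Lemma diagonal_c_entropy : resolvent_set T (- 'i%C) ->
  (forall i, Num.conj (t i) != - 'i%C) ->
  c_entropy T K J =
  (\sum_i (ln (Normc.normc (t i + 'i%C)) -
           ln (Normc.normc (Num.conj (t i) + 'i%C))))%:E.
Proof.
move=> rhoT tz'; rewrite /c_entropy asboolT //.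
rewrite diagonal_neg_tr_ln_abs //; last first.
  by move: rhoT; rewrite TE resolvent_set_diag_op.
by rewrite opprK.
Qed.

(** As [z] tends to the common eigenvalue [c], each distance [|c - z|] tends to
    [0], while the conjugate of [c], at distance [2 b] from [c], stays at
    distance at least [b] from [z]; so each difference of logarithms tends to
    [-oo]. *)
Lemma diagonal_entropy_pole (c : R[i]) : (0 < n)%N -> 0 < b ->
  (forall i, t i = c) ->
  neg_tr_ln_abs (transfer_fun T K J z) @[z --> within (resolvent_set T)
    ((c : R[i]^o)^')] --> -oo%E.
Proof.
move=> n0 b0 tc; have Im_c : complex.Im c = - b by rewrite -(tc (Ordinal n0)).
have conj_dist : 2 * b = Normc.normc (Num.conj c - c).
  apply: complexI; rewrite -normE_normc -normrN opprB.
  rewrite (subcJ c : _ - Num.conj _ = _) Im_c normrM complexiE normCi mulr1.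
  rewrite rmorphM normrM normr_nat rmorphN normrN ger0_norm ?lecR //.
  by rewrite rmorph_nat.
(* With [|c - z| < d] each of the [n] summands is at most
   [ln d - ln b = - |A|]. *)
apply/cvgeNyPle => A; pose d := b * expR (- `|A|).
have d0 : 0 < d by rewrite mulr_gt0 // expR_gt0.
have db : d <= b.
  by rewrite ger_pMr // -expR0 ler_expR oppr_le0 normr_ge0.
apply/nbhs_ballP; exists (d%:C%C) => /=; first by rewrite ltcR.
move=> z; rewrite -ball_normE /= normE_normc ltcR.
move=> cz zc _.
have tz i : t i != z by rewrite tc eq_sym.
have cz0 : 0 < Normc.normc (c - z).
  by rewrite normc_gt0 subr_eq0 eq_sym.
have bz : b <= Normc.normc (Num.conj c - z).
  have : 2 * b <= Normc.normc (Num.conj c - z) + Normc.normc (c - z).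
    rewrite conj_dist -(normcN (c - z)) opprB.
    by rewrite (le_trans _ (le_normcD _ _)) // addrA subrK.
  by move: cz db; lra.
have tz' i : Num.conj (t i) != z.
  by rewrite tc -subr_eq0 -normc_gt0 (lt_le_trans b0).
rewrite diagonal_neg_tr_ln_abs // lee_fin.
under eq_bigr do rewrite tc.
rewrite sumr_const card_ord.
have le_A :
    ln (Normc.normc (c - z)) - ln (Normc.normc (Num.conj c - z)) <= - `|A|.
  have : ln (Normc.normc (c - z)) <= ln d by rewrite ler_ln ?posrE // ltW.
  rewrite lnM ?posrE ?expR_gt0 // expRK.
  have : ln b <= ln (Normc.normc (Num.conj c - z)).
    by rewrite ler_ln ?posrE // (lt_le_trans b0).
  lra.
apply: (@le_trans _ _ (- `|A| *+ n)); first by rewrite lerMn2r le_A orbT.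
rewrite (@le_trans _ _ (- `|A|)) ?lerNnormlW //.
by rewrite -mulr_natr ler_neMr ?oppr_le0 // ler1n.
Qed.

End DiagonalSystem.

Theorem theorem10 (R : realType) (H : hilbertSpace R) (h : 'I_2 -> H)
    (hh : orthonormal_basis h)
    (lambda0 : R[i]) (Im_gt0 : 0 < complex.Im lambda0)
    (T : {linear H -> H}) (K : {linear Cn R 2 -> H})
    (J : {linear Cn R 2 -> Cn R 2})
    (T0 : T (h 0) = Num.conj lambda0 *: h 0)
    (T1 : T (h 1) = - lambda0 *: h 1)
    (KE : forall c : 'cV[R[i]]_2,
       K c = (Num.sqrt (complex.Im lambda0))%:C%C *:
               (c 0 0 *: h 0 + c 1 0 *: h 1))
    (JE : forall c : 'cV[R[i]]_2, J c = - c) :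
  [/\ canonical_L_system T K J,
      (c_entropy T K J < 0)%E
    & accumulation_coef T K J =
        8 * complex.Im lambda0 * (Normc.normc lambda0 ^+ 2 + 1) /
        (Normc.normc lambda0 ^+ 2 + 2 * complex.Im lambda0 + 1) ^+ 2].
Proof.
set b := complex.Im lambda0 in Im_gt0 KE *.
have b0 := ltW Im_gt0.
have ord2 (i : 'I_2) : i = 0 \/ i = 1.
  by case: i => [[|[|//]] ?]; [left|right]; exact: val_inj.
pose t (i : 'I_2) := if i == 0 then Num.conj lambda0 else - lambda0.
have Im_t i : complex.Im (t i) = - b.
  by rewrite /t /b; case: ifP; case: (lambda0).
have TE : (T : H -> H) = diag_op h h t.
  by apply: linear_diag_op => // i; case: (ord2 i) => ->.
have KdE : (K : Cn R 2 -> H) =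
    diag_op (@std_basis R 2) h (fun=> (Num.sqrt b)%:C%C).
  apply: linear_diag_op => [|i]; first exact: std_basis_orthonormal.
  rewrite KE /std_basis !mxE.
  by case: (ord2 i) => -> /=; rewrite scale1r scale0r ?addr0 ?add0r.
have JdE : (J : Cn R 2 -> Cn R 2) =
    diag_op (@std_basis R 2) (@std_basis R 2) (fun=> -1).
  apply: linear_diag_op => [|i]; first exact: std_basis_orthonormal.
  by rewrite JE scaleN1r.
have Lsys := diagonal_canonical_L_system hh b0 Im_t TE KdE JdE.
set q := Normc.normc lambda0 ^+ 2.
have qE : q = complex.Re lambda0 ^+ 2 + b ^+ 2.
  rewrite /q /b; case: (lambda0) => u v /=.
  by rewrite sqr_sqrtr ?addr_ge0 ?sqr_ge0.
(* The squared distances from [- i] to both eigenvalues of [T], and to both of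
   their conjugates. *)
pose D := q + 1 - 2 * b; pose N := q + 1 + 2 * b.
have D_ge0 : 0 <= D.
  have -> : D = complex.Re lambda0 ^+ 2 + (b - 1) ^+ 2 by rewrite /D qE; ring.
  by rewrite addr_ge0 ?sqr_ge0.
have D_lt_N : D < N by rewrite /D /N; lra.
have N_gt0 : 0 < N := le_lt_trans D_ge0 D_lt_N.
have normD i : Normc.normc (t i + 'i%C) = Num.sqrt D.
  rewrite /D qE /b /t; case: (ord2 i) => -> /=; case: (lambda0) => u v /=.
    by congr Num.sqrt; ring.
  by congr Num.sqrt; ring.
have normN i : Normc.normc (Num.conj (t i) + 'i%C) = Num.sqrt N.
  rewrite /N qE /b /t; case: (ord2 i) => -> /=; case: (lambda0) => u v /=.
    by congr Num.sqrt; ring.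
  by congr Num.sqrt; ring.
have tNi i : (t i != - 'i%C) = (0 < D).
  by rewrite -sqrtr_gt0 -(normD i) normc_gt0 addr_eq0.
have rhoE z := resolvent_set_diag_op t z hh.
suff [SE AE] : (c_entropy T K J < 0)%E /\
    expeR (2%:E * c_entropy T K J)%E = ((D / N) ^+ 2)%:E.
  split=> //; rewrite /accumulation_coef AE /=.
  have N0 : N != 0 by rewrite gt_eqF.
  rewrite -[in RHS](_ : N = q + 2 * b + 1); last by rewrite /N; ring.
  by rewrite /D; move: N0; rewrite /N => N0; field.
(* [D = 0] means that [lambda0 = i], when the entropy is a limit. *)
have [D0|D0] := eqVneq D 0.
  have tE i : t i = - 'i%C by apply/eqP; rewrite -[_ == _]negbK tNi D0 ltxx.
  have -> : c_entropy T K J = -oo%E.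
    rewrite /c_entropy asboolF; last first.
      by rewrite TE => /rhoE /(_ 0); rewrite tE eqxx.
    have Fproper :
        ProperFilter (within (resolvent_set T) ((- 'i%C : R[i]^o)^')).
      rewrite (_ : within _ _ = (- 'i%C : R[i]^o)^').
        exact: Proper_dnbhs_regular_numFieldType.
      have rho : (- 'i%C : R[i]^o)^' (resolvent_set T).
        exists (1 : R[i]) => //= z _ zi; rewrite TE; apply/rhoE => i.
        by rewrite tE eq_sym.
      apply/funext => P; apply/propext; split; last first.
        by apply: filterS => z.
      by rewrite /within /=; apply: filterS2 rho => z ? ; apply.
    apply: cvg_lim => //.
    by apply: (diagonal_entropy_pole hh b0 Im_t TE KdE JdE).
  by rewrite ltNyr mulrNy gtr0_sg // mul1e D0 mul0r expr0n.
have {D0 D_ge0} D_gt0 : 0 < D by rewrite lt_neqAle eq_sym D0.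
rewrite (diagonal_c_entropy hh b0 Im_t TE KdE JdE); first last.
- by move=> i; rewrite -addr_eq0 -normc_gt0 normN sqrtr_gt0.
- by rewrite TE; apply/rhoE => i; rewrite tNi.
under eq_bigr do rewrite normD normN.
rewrite sumr_const card_ord -ln_div ?posrE ?sqrtr_gt0 //.
rewrite -sqrtrV ?ltW // -sqrtrM ?ltW //.
have DN0 : 0 < D / N by rewrite divr_gt0.
have -> : ln (Num.sqrt (D / N)) *+ 2 = ln (D / N).
  by rewrite -lnXn ?sqrtr_gt0 // sqr_sqrtr ?ltW.
split; first by rewrite lte_fin ln_lt0 // DN0 ltr_pdivrMr // mul1r.
by rewrite -EFinM /= expRM_natl lnK.
Qed.
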